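(* Let $R$ be a ring and let $\mathcal{Q}(R)$ be the set of all quasi-orderings on $R$. For $\preceq_1,\preceq_2\in\mathcal{Q}(R)$ define \[ \preceq_1\,\leq'\,\preceq_2\ :\Leftrightarrow\ \preceq_1\,\leq\,\preceq_2\ \text{ and }\ \mathfrak{q}_{\preceq_2}\subseteq\mathfrak{q}_{\preceq_1}, \] where $\leq$ is the coarsening relation and $\mathfrak{q}_{\preceq}$ denotes the support of $\preceq$. Then $\leq'$ is a partial ordering that yields a partition of $\mathcal{Q}(R)$ into the rooted trees $\mathcal{Q}_{\mathfrak{q}}(R)$, where $\mathfrak{q}$ runs over all two-sided completely prime ideals of $R$ and $\mathcal{Q}_{\mathfrak{q}}(R)$ is the set of quasi-orderings on $R$ with support $\mathfrak{q}$. Moreover, $(\mathcal{Q}(R),\leq')$ is a tree.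
   Context: Rings have a unit $1$ and are not necessarily commutative. A two-sided ideal $\mathfrak{q}\neq R$ is completely prime if $xy\in\mathfrak{q}$ implies $x\in\mathfrak{q}$ or $y\in\mathfrak{q}$. A quasi-ordering on a ring $R$ is a reflexive, transitive and total binary relation $\preceq$ on $R$ such that, writing $x\sim y$ if $x\preceq y$ and $y\preceq x$, $x\nsim y$ if not $x\sim y$, and $x\prec y$ if $x\preceq y$ but not $y\preceq x$, for all $a,b,x,y,z\in R$: (QR1) $0\prec 1$; (QR2) if $0\preceq a,b$ and $x\preceq y$, then $axb\preceq ayb$; (QR3) if $0\prec a,b$ and $axb\preceq ayb$, then $x\preceq y$; (QR4) if $z\nsim y$ and $x\preceq y$, then $x+z\preceq y+z$. Its support is $\mathfrak{q}_{\preceq}=\{x\in R: x\sim 0\}$. Coarsening relation: for quasi-orderings $\preceq_1,\preceq_2$ on $R$, $\preceq_1\leq\preceq_2$ (read: $\preceq_2$ is coarser than $\preceq_1$) if for all $x,y\in R$: $0\preceq_1 x\preceq_1 y\Rightarrow x\preceq_2 y$. A partially ordered set $(S,\leq)$ is a tree if for all $s,s_1,s_2\in S$ with $s\leq s_1$ and $s\leq s_2$ one has $s_1\leq s_2$ or $s_2\leq s_1$. A rooted tree is a tree that admits a maximum. *)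

(* Defs.v *)
From mathcomp Require Import all_boot all_algebra.
From mathcomp Require Import boolp classical_sets.

Set Implicit Arguments.
Unset Strict Implicit.
Unset Printing Implicit Defensive.

Import GRing.Theory.
Local Open Scope classical_set_scope.
Local Open Scope ring_scope.

Section PartialOrdersOnSets.
Variables (T : Type) (S : set T) (le : T -> T -> Prop).

Record partial_order_on : Prop := PartialOrderOn {
  po_refl : forall s, S s -> le s s;
  po_antisym : forall s t, S s -> S t -> le s t -> le t s -> s = t;
  po_trans : forall s t u, S s -> S t -> S u -> le s t -> le t u -> le s u
}.

Definition tree_on : Prop :=
  partial_order_on /\
  forall s s1 s2, S s -> S s1 -> S s2 ->
    le s s1 -> le s s2 -> le s1 s2 \/ le s2 s1.

Definition rooted_tree_on : Prop :=
  tree_on /\ exists2 m, S m & forall s, S s -> le s m.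

End PartialOrdersOnSets.

Section QuasiOrderings.
Variable R : pzRingType.
Implicit Types (le : R -> R -> Prop) (q : set R).

Definition qsim le (x y : R) : Prop := le x y /\ le y x.

Definition qlt le (x y : R) : Prop := le x y /\ ~ le y x.

Record quasi_ordering le : Prop := QuasiOrdering {
  qo_refl : forall x, le x x;
  qo_trans : forall x y z, le x y -> le y z -> le x z;
  qo_total : forall x y, le x y \/ le y x;
  qo_QR1 : qlt le 0 1;
  qo_QR2 : forall a b x y,
    le 0 a -> le 0 b -> le x y -> le (a * x * b) (a * y * b);
  qo_QR3 : forall a b x y,
    qlt le 0 a -> qlt le 0 b -> le (a * x * b) (a * y * b) -> le x y;
  qo_QR4 : forall x y z, ~ qsim le z y -> le x y -> le (x + z) (y + z)
}.

Definition qsupport le : set R := [set x | qsim le x 0].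

Definition quasi_orderings : set (R -> R -> Prop) :=
  [set le | quasi_ordering le].

Definition quasi_orderings_with_support q : set (R -> R -> Prop) :=
  [set le | quasi_ordering le /\ qsupport le = q].

(* [coarsening le1 le2] is le1 <= le2, i.e. le2 is coarser than le1. *)
Definition coarsening (le1 le2 : R -> R -> Prop) : Prop :=
  forall x y, le1 0 x -> le1 x y -> le2 x y.

Definition supp_coarsening (le1 le2 : R -> R -> Prop) : Prop :=
  coarsening le1 le2 /\ qsupport le2 `<=` qsupport le1.

(* The ideals of ring_quotient are one-sided and need a nonzero ring. Closure
   under opposites is implied by ideal_mull, since - x = -1 * x. *)
Record two_sided_ideal q : Prop := TwoSidedIdeal {
  ideal_0 : q 0;
  ideal_add : forall x y, q x -> q y -> q (x + y);
  ideal_mull : forall a x, q x -> q (a * x);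
  ideal_mulr : forall a x, q x -> q (x * a)
}.

Definition completely_prime q : Prop :=
  [/\ two_sided_ideal q, q <> setT
    & forall x y, q (x * y) -> q x \/ q y].

End QuasiOrderings.

Arguments quasi_orderings R : clear implicits.
Arguments supp_coarsening {R}.
Arguments quasi_orderings_with_support {R}.

(* Main.v *)
Require Import Defs.
From mathcomp Require Import all_boot all_algebra.
From mathcomp Require Import boolp classical_sets.

Set Implicit Arguments.
Unset Strict Implicit.
Unset Printing Implicit Defensive.

Local Open Scope classical_set_scope.
Local Open Scope ring_scope.

(** The proof rests on a dichotomy for a quasi-ordering [le], decided by the
    sign of [-1]. If [0 <= -1], then [1] and [-1] are equivalent, so every
    element is equivalent to its opposite and is nonnegative: [le] behaves like
    the comparison of the values of a valuation ([valuative_sym],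
    [valuative_ge0]). Otherwise [le] behaves like a ring ordering modulo its
    support: [x <= y] if and only if [0 <= y - x] ([ordering_sub_ge0]).

    In both cases [le] is determined by its restriction to the nonnegative
    elements, which is what the coarsening relation sees; hence antisymmetry.
    A coarsening never shrinks the support, so comparability for
    [supp_coarsening] forces equal supports. Supports are completely prime
    ideals, and the block over such an ideal [q] has as its maximum the trivial
    valuation with support [q], which only distinguishes [q] from its
    complement.

    For the tree property let [le1] and [le2] both coarsen [le] with the same
    support. If [le1] is of ordering type, then so is [le], whose nonnegative
    elements are those of [le1]; so [le1] also lies below [le], hence below
    [le2] ([coarsening_ordering_sym]). If both are valuative and neither
    coarsens the other, there are witnesses with [x <=1 y], [y <2 x],
    [u <=2 w], [w <1 u]. Multiplying them gives [x w <1 y u] and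
    [y u <2 x w], whereas [le] compares [x w] and [y u] up to sign and imposes
    its verdict on both [le1] and [le2]. *)

Import GRing.Theory.

(** * Supports and signs *)

Section Support.
Variables (R : pzRingType) (le : R -> R -> Prop).
Hypothesis qo : quasi_ordering le.
Implicit Types a b x y z : R.

Let refl x : le x x := qo_refl qo x.
Let trans x y z : le x y -> le y z -> le x z := @qo_trans _ _ qo x y z.

Lemma qsim_sym x y : qsim le x y -> qsim le y x.
Proof. by case. Qed.

Lemma qsim_trans x y z : qsim le x y -> qsim le y z -> qsim le x z.
Proof. by move=> [xy yx] [yz zy]; split; [exact: trans yz | exact: trans yx]. Qed.

Lemma not_qsim0_1 : ~ qsim le 1 0.
Proof. by case: (qo_QR1 qo) => _ n10 []. Qed.

(** Translating [x <= 0] and [0 <= x] by [y] through QR4, which requires [y] to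
    be equivalent neither to [0] nor to [x]. *)
Lemma qsim_add_nsupp x y : qsim le x 0 -> ~ qsim le y 0 -> qsim le (x + y) y.
Proof.
move=> x0 ny0; have [lx0 l0x] := x0; split.
  by have := qo_QR4 qo ny0 lx0; rewrite add0r.
have nyx : ~ qsim le y x by move=> yx; exact: ny0 (qsim_trans yx x0).
by have := qo_QR4 qo nyx l0x; rewrite add0r.
Qed.

Lemma qsim0_opp x : qsim le x 0 -> qsim le (- x) 0.
Proof.
move=> x0; apply: contrapT => nx.
by have := qsim_add_nsupp x0 nx; rewrite subrr => /qsim_sym.
Qed.

Lemma qsim0_oppE x : qsim le (- x) 0 <-> qsim le x 0.
Proof. by split=> /qsim0_opp //; rewrite opprK. Qed.

Lemma qsim0_add x y : qsim le x 0 -> qsim le y 0 -> qsim le (x + y) 0.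
Proof.
move=> x0 y0; apply: contrapT => nxy.
have := qsim_add_nsupp (qsim0_opp x0) nxy; rewrite addKr => yxy.
exact: nxy (qsim_trans (qsim_sym yxy) y0).
Qed.

Lemma qsim_addl x y : qsim le x 0 -> qsim le (x + y) y.
Proof.
move=> x0; have [y0|] := pselect (qsim le y 0); last exact: qsim_add_nsupp.
exact: qsim_trans (qsim0_add x0 y0) (qsim_sym y0).
Qed.

Lemma opp_ge0 x : le x 0 -> le 0 (- x).
Proof.
move=> lx0; have [[]//|nx] := pselect (qsim le (- x) 0).
by have := qo_QR4 qo nx lx0; rewrite subrr add0r.
Qed.

Lemma exists_signed_ge0 x : exists2 x', x' = x \/ x' = - x & le 0 x'.
Proof.
have [x0|/opp_ge0 x0] := qo_total qo 0 x; first by exists x; [left|].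
by exists (- x); [right|].
Qed.

Lemma ge0_nsupp_gt0 x : le 0 x -> ~ qsim le x 0 -> qlt le 0 x.
Proof. by move=> x0 nx; split=> // lx0; apply: nx. Qed.

Lemma QR2l a x y : le 0 a -> le x y -> le (a * x) (a * y).
Proof.
by move=> a0 /(qo_QR2 qo a0 (proj1 (qo_QR1 qo))); rewrite !mulr1.
Qed.

Lemma QR2r b x y : le 0 b -> le x y -> le (x * b) (y * b).
Proof.
by move=> b0 /(qo_QR2 qo (proj1 (qo_QR1 qo)) b0); rewrite !mul1r.
Qed.

Lemma QR3l a x y : qlt le 0 a -> le (a * x) (a * y) -> le x y.
Proof. by move=> a0 axy; apply: (qo_QR3 qo a0 (qo_QR1 qo)); rewrite !mulr1. Qed.

Lemma QR3r b x y : qlt le 0 b -> le (x * b) (y * b) -> le x y.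
Proof. by move=> b0 xyb; apply: (qo_QR3 qo (qo_QR1 qo) b0); rewrite !mul1r. Qed.

Lemma qsim0_mull a x : qsim le x 0 -> qsim le (a * x) 0.
Proof.
move=> [lx0 l0x]; have [a' Ea' a0] := exists_signed_ge0 a.
have : qsim le (a' * x) 0.
  by split; [have := QR2l a0 lx0 | have := QR2l a0 l0x]; rewrite mulr0.
by case: Ea' => -> //; rewrite mulNr => /qsim0_oppE.
Qed.

Lemma qsim0_mulr a x : qsim le x 0 -> qsim le (x * a) 0.
Proof.
move=> [lx0 l0x]; have [a' Ea' a0] := exists_signed_ge0 a.
have : qsim le (x * a') 0.
  by split; [have := QR2r a0 lx0 | have := QR2r a0 l0x]; rewrite mul0r.
by case: Ea' => -> //; rewrite mulrN => /qsim0_oppE.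
Qed.

(** After a change of sign the first factor is positive, and QR3 cancels it. *)
Lemma completely_prime_qsupp : completely_prime (qsupport le).
Proof.
split; first split.
- exact: (conj (refl 0) (refl 0)).
- exact: qsim0_add.
- exact: qsim0_mull.
- exact: qsim0_mulr.
- by move=> qT; apply: not_qsim0_1; change (qsupport le 1); rewrite qT.
- move=> x y xy0; have [|nx] := pselect (qsim le x 0); [by left | right].
  have [x' Ex' x'0] := exists_signed_ge0 x.
  have [x'gt0 [xyle xyge]] : qlt le 0 x' /\ qsim le (x' * y) 0.
    case: Ex' x'0 => -> x'0; first by split=> //; exact: ge0_nsupp_gt0.
    split; first by apply: ge0_nsupp_gt0 => // /qsim0_oppE.
    by rewrite mulNr; exact: qsim0_opp.
  by split; apply: (QR3l x'gt0); rewrite mulr0.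
Qed.

(** * Valuative and ordering type *)

(** Multiplying by [-1 >= 0] turns each of [-1 <= 1], [1 <= -1] into the
    other, so both hold by totality. *)
Lemma valuative_sym x : le 0 (-1) -> qsim le (- x) x.
Proof.
move=> N1ge0.
have flip a b : le a b -> le (- a) (- b).
  by move=> /(QR2l N1ge0); rewrite !mulN1r.
have [le1N leN1] : qsim le (-1) 1.
  by case: (qo_total qo 1 (-1)) => h; split=> //; have := flip _ _ h; rewrite opprK.
have simN y : le 0 y -> qsim le (- y) y.
  by move=> y0; split; [have := QR2l y0 le1N | have := QR2l y0 leN1];
     rewrite mulr1 mulrN1.
have [/simN//|/opp_ge0/simN] := qo_total qo 0 x.
by rewrite opprK => /qsim_sym.
Qed.

Lemma valuative_ge0 x : le 0 (-1) -> le 0 x.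
Proof.
move=> N1ge0; have [//|/opp_ge0 Nx] := qo_total qo 0 x.
by case: (valuative_sym x N1ge0) => Nxx _; exact: trans Nxx.
Qed.

Lemma valuative_signed x x' : le 0 (-1) -> x' = x \/ x' = - x -> qsim le x' x.
Proof. by move=> N1 [] ->; [split | exact: valuative_sym]. Qed.

Lemma ordering_opp_le0 x : ~ le 0 (-1) -> le 0 x -> le (- x) 0.
Proof.
move=> nN1 x0; have [//|N1] := qo_total qo 0 (-1).
by have := QR2l x0 N1; rewrite mulrN1 mulr0.
Qed.

(** QR4 gives [b <= a + b] unless [a] and [b] are equivalent. In that case,
    if [b] is outside the support and [a + b <= 0], translating by [- b] gives
    [a <= - b <= 0], which contradicts [0 < b <= a]. *)
Lemma ordering_add_ge0 a b : ~ le 0 (-1) -> le 0 a -> le 0 b -> le 0 (a + b).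
Proof.
move=> nN1 a0 b0; have [//|lab0] := qo_total qo 0 (a + b).
have [ba|nba] := pselect (qsim le b a); last first.
  by apply: trans b0 _; have := qo_QR4 qo nba a0; rewrite add0r.
have [bs|nbs] := pselect (qsim le b 0).
  by rewrite addrC; apply: trans a0 _; case: (qsim_addl a bs).
have nNb : ~ qsim le (- b) 0 by move=> /qsim0_oppE.
have := qo_QR4 qo nNb lab0; rewrite addrK add0r => aNb.
case: nbs; split=> //.
by apply: trans (proj1 ba) _; apply: trans aNb _; exact: ordering_opp_le0.
Qed.

Lemma ordering_sub_ge0 x y : ~ le 0 (-1) -> le x y <-> le 0 (y - x).
Proof.
move=> nN1.
have fwd u v : le u v -> le 0 (v - u).
  move=> uv; have [[Nuv vNu]|nNu] := pselect (qsim le (- u) v); last first.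
    by have := qo_QR4 qo nNu uv; rewrite subrr.
  (* Here [- u] and [v] are equivalent; [u <= v] excludes both being
     negative. *)
  have v0 : le 0 v.
    have [//|v0] := qo_total qo 0 v.
    have u0 : le 0 u by rewrite -[u]opprK; apply: opp_ge0; exact: trans v0.
    exact: trans uv.
  by apply: ordering_add_ge0 => //; exact: trans vNu.
split=> [/fwd//|yx0].
have [//|/fwd xy0] := qo_total qo x y.
have /(qsim_addl x) [_] : qsim le (y - x) 0.
  by split=> //; rewrite -opprB; exact: ordering_opp_le0.
by rewrite subrK.
Qed.

End Support.

(** * The coarsening relation *)

Section Coarsening.
Variable R : pzRingType.
Implicit Types le : R -> R -> Prop.

Lemma coarsening_ge0 le le' x :
  quasi_ordering le -> coarsening le le' -> le 0 x -> le' 0 x.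
Proof. by move=> qo c; apply: c; exact: qo_refl. Qed.

Lemma coarsening_trans le1 le2 le3 :
    quasi_ordering le1 -> coarsening le1 le2 -> coarsening le2 le3 ->
  coarsening le1 le3.
Proof.
move=> qo1 c12 c23 x y x0 xy; apply: c23; last exact: c12.
exact: coarsening_ge0 x0.
Qed.

Lemma coarsening_qsupp le1 le2 :
    quasi_ordering le1 -> coarsening le1 le2 ->
  qsupport le1 `<=` qsupport le2.
Proof. by move=> qo1 c x [x0 x0']; split; [exact: c | exact: coarsening_ge0 x0']. Qed.

Lemma supp_coarsening_qsupp le1 le2 :
    quasi_ordering le1 -> supp_coarsening le1 le2 ->
  qsupport le1 = qsupport le2.
Proof.
by move=> qo1 [c s]; apply/seteqP; split=> //; exact: coarsening_qsupp.
Qed.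

(** The coarsening relation only constrains nonnegative elements; all elements
    are such in the valuative case, and in the ordering case [x <= y] is the
    nonnegativity of [y - x]. *)
Lemma mutual_coarsening_le le1 le2 x y :
    quasi_ordering le1 -> quasi_ordering le2 ->
    coarsening le1 le2 -> coarsening le2 le1 ->
  le1 x y -> le2 x y.
Proof.
move=> qo1 qo2 c12 c21.
have [v1|o1] := pselect (le1 0 (-1)).
  by apply: c12; exact: valuative_ge0.
have o2 : ~ le2 0 (-1) by move=> /(coarsening_ge0 qo2 c21).
move=> /(ordering_sub_ge0 qo1 _ _ o1) h; apply/(ordering_sub_ge0 qo2 _ _ o2).
exact: coarsening_ge0 h.
Qed.

Lemma partial_order_supp_coarsening :
  partial_order_on (quasi_orderings R) supp_coarsening.
Proof.
split=> [le _|le1 le2 qo1 qo2 [c12 _] [c21 _]|le1 le2 le3 qo1 _ _ [c12 s21] [c23 s32]].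
- by split=> // x y _.
- apply/funext => x; apply/funext => y; apply/propext.
  by split; apply: mutual_coarsening_le.
- by split; [exact: coarsening_trans c23 | exact: subset_trans s21].
Qed.

(** The nonnegative elements of [le] remain so in [le1]. Conversely, if [x] is
    nonnegative in [le1] but not in [le], then [- x] is nonnegative in both, so
    [x] lies in the support of [le1], hence in that of [le]. *)
Lemma coarsening_ordering_sym le le1 :
    quasi_ordering le -> quasi_ordering le1 -> ~ le1 0 (-1) ->
    supp_coarsening le le1 ->
  coarsening le1 le.
Proof.
move=> qo qo1 o1 [c s] x y _ /(ordering_sub_ge0 qo1 _ _ o1).
have o : ~ le 0 (-1) by move=> /(coarsening_ge0 qo c).
move: (y - x) (ordering_sub_ge0 qo x y o) => d leE d0; apply/leE.
have [//|/(opp_ge0 qo)/(coarsening_ge0 qo c) Nd0] := qo_total qo 0 d.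
have /s[] // : qsim le1 d 0.
by split=> //; rewrite -[d]opprK; exact: ordering_opp_le0.
Qed.

Lemma supp_coarsening_valuative_total le le1 le2 :
    quasi_ordering le -> quasi_ordering le1 -> quasi_ordering le2 ->
    le1 0 (-1) -> le2 0 (-1) ->
    supp_coarsening le le1 -> supp_coarsening le le2 ->
  coarsening le1 le2 \/ coarsening le2 le1.
Proof.
move=> qo qo1 qo2 v1 v2 sc1 sc2.
have [|nc12] := pselect (coarsening le1 le2); [by left | right].
move=> u w _ uw; apply: contrapT => nuw.
apply: nc12 => x y _ xy; apply: contrapT => nxy.
have suppE : qsupport le1 = qsupport le2.
  by rewrite -(supp_coarsening_qsupp qo sc1) (supp_coarsening_qsupp qo sc2).
have ge1 a : le1 0 a by exact: valuative_ge0.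
have ge2 a : le2 0 a by exact: valuative_ge0.
(* If [y] were in the common support, so would [x], and then [x <=2 y]. *)
have y_gt0 : qlt le1 0 y.
  split=> // y0.
  have : qsupport le1 x by split=> //; exact: qo_trans y0.
  by rewrite suppE => -[x0 _]; apply: nxy; exact: qo_trans x0 _.
have w_gt0 : qlt le2 0 w.
  split=> // w0.
  have : qsupport le2 u by split=> //; exact: qo_trans w0.
  by rewrite -suppE => -[u0 _]; apply: nuw; exact: qo_trans u0 _.
have n1 : ~ le1 (y * u) (x * w).
  move=> h; apply: nuw; apply: (QR3l qo1 y_gt0).
  by apply: (qo_trans qo1 h); exact: QR2r.
have n2 : ~ le2 (x * w) (y * u).
  move=> h; apply: nxy; apply: (QR3r qo2 w_gt0).
  by apply: (qo_trans qo2 h); exact: QR2l.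
have [a Ea a0] := exists_signed_ge0 qo (x * w).
have [b Eb b0] := exists_signed_ge0 qo (y * u).
have [ab|ba] := qo_total qo a b.
  apply: n2; apply: (qo_trans qo2 (proj2 (valuative_signed qo2 v2 Ea))).
  apply: (qo_trans qo2 _ (proj1 (valuative_signed qo2 v2 Eb))).
  exact: (proj1 sc2).
apply: n1; apply: (qo_trans qo1 (proj2 (valuative_signed qo1 v1 Eb))).
apply: (qo_trans qo1 _ (proj1 (valuative_signed qo1 v1 Ea))).
exact: (proj1 sc1).
Qed.

Lemma tree_supp_coarsening : tree_on (quasi_orderings R) supp_coarsening.
Proof.
split; first exact: partial_order_supp_coarsening.
move=> le le1 le2 qo qo1 qo2 sc1 sc2.
have E1 := supp_coarsening_qsupp qo sc1.
have E2 := supp_coarsening_qsupp qo sc2.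
suff [c|c] : coarsening le1 le2 \/ coarsening le2 le1.
- by left; split=> //; rewrite -E1 -E2.
- by right; split=> //; rewrite -E1 -E2.
have [v1|o1] := pselect (le1 0 (-1)); last first.
  left; apply: (coarsening_trans qo1 _ (proj1 sc2)).
  exact: coarsening_ordering_sym.
have [v2|o2] := pselect (le2 0 (-1)); last first.
  right; apply: (coarsening_trans qo2 _ (proj1 sc1)).
  exact: coarsening_ordering_sym.
exact: supp_coarsening_valuative_total v1 v2 sc1 sc2.
Qed.

End Coarsening.

Lemma tree_on_subset (T : Type) (S S' : set T) (le : T -> T -> Prop) :
  S' `<=` S -> tree_on S le -> tree_on S' le.
Proof.
move=> sub [[r a t] tr]; split; first split.
- by move=> s /sub; exact: r.
- by move=> s u /sub Ss /sub; exact: a.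
- by move=> s u v /sub Ss /sub Su /sub; exact: t.
- by move=> s u v /sub Ss /sub Su /sub; exact: tr.
Qed.

(** * Blocks of the partition *)

Section Blocks.
Variables (R : pzRingType) (q : set R).
Hypothesis cpq : completely_prime q.

(** The comparison of values, in reverse, for the valuation that is infinite
    on [q] and [0] elsewhere. *)
Definition trivial_valuation (x y : R) : Prop := q y -> q x.

Lemma trivial_valuation_block :
  quasi_orderings_with_support q trivial_valuation.
Proof.
case: cpq => -[q0 qD qMl qMr] qT qP.
have q1 : ~ q 1.
  by move=> q1; apply: qT; apply/seteqP; split=> // x _; rewrite -[x]mulr1; exact: qMl.
have qN x : q x -> q (- x) by move=> /(qMl (-1)); rewrite mulN1r.
have qP3 a x b : q (a * x * b) -> [\/ q a, q x | q b].
  by move=> /qP[/qP[]|]; [constructor 1 | constructor 2 | constructor 3].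
have qM3 a x b : q x -> q (a * x * b) by move=> qx; apply: qMr; exact: qMl.
split; first split.
- by move=> x.
- by move=> x y z xy yz /yz.
- by move=> x y; have [qx|nqx] := pselect (q x); [left | right].
- by split=> [_|/(_ q0)].
- move=> a b x y _ _ xy /qP3[qa|/xy/qM3 //|qb]; last exact: qMl.
  exact: qMr (qMr _ _ qa).
- by move=> a b x y [_ na] [_ nb] xy /qM3/xy/qP3[qa|//|qb]; [case: na | case: nb].
- (* As [z] and [y] are not equivalent, exactly one of them is in [q]; so
     [y + z] is not, and lies above everything. *)
  move=> x y z nzy xy qyz; exfalso; apply: nzy; split=> [qy|qz].
    by rewrite -[z](addKr y); apply: qD => //; exact: qN.
  by rewrite -[y](addrK z); apply: qD => //; exact: qN.
- by apply/seteqP; split=> [x [x0 _]|x qx]; [exact: x0 | split].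
Qed.

Lemma trivial_valuation_max le :
  quasi_orderings_with_support q le -> supp_coarsening le trivial_valuation.
Proof.
move=> [qo leq]; case: trivial_valuation_block => _ tq.
split; last by rewrite tq leq.
move=> x y x0 xy; rewrite /trivial_valuation -leq => -[y0 _].
by split=> //; exact: qo_trans y0.
Qed.

Lemma rooted_tree_block :
  rooted_tree_on (quasi_orderings_with_support q) supp_coarsening.
Proof.
split; last first.
  by exists trivial_valuation;
    [exact: trivial_valuation_block | exact: trivial_valuation_max].
by apply: tree_on_subset (@tree_supp_coarsening R) => le [].
Qed.

End Blocks.

Theorem corollary5p10 (R : pzRingType) :
  [/\ partial_order_on (quasi_orderings R) supp_coarsening,
      (* the sets Q_q form a partition of Q(R), whose blocks are unrelated
         to each other and are each a rooted tree *)
      [/\ classical_sets.partition [set q : set R | completely_prime q]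
            quasi_orderings_with_support (quasi_orderings R),
          (forall (q1 q2 : set R) (le1 le2 : R -> R -> Prop),
             completely_prime q1 -> completely_prime q2 ->
             quasi_orderings_with_support q1 le1 ->
             quasi_orderings_with_support q2 le2 ->
             supp_coarsening le1 le2 -> q1 = q2)
        & (forall q : set R, completely_prime q ->
             rooted_tree_on (quasi_orderings_with_support q) supp_coarsening)]
    & tree_on (quasi_orderings R) supp_coarsening].
Proof.
split; [exact: partial_order_supp_coarsening| |exact: tree_supp_coarsening].
split; last exact: rooted_tree_block.
- split.
  + apply/seteqP; split=> [le [q _ []] //|le qo].
    by exists (qsupport le); [exact: completely_prime_qsupp | split].
  + by move=> q1 q2 _ _ [le [[_ <-] [_ <-]]].
  + by move=> q cpq; exists (trivial_valuation q); exact: trivial_valuation_block.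
- move=> q1 q2 le1 le2 _ _ [qo1 <-] [qo2 <-]; exact: supp_coarsening_qsupp.
Qed.
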